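(* For $n\ge 1$, the number $s_n^1(2413)$ of partial permutations of length $n$ with exactly one hole that avoid $2413$ equals $\frac{2}{n+1}\binom{2n}{n}-2^{n-1}$.
   Context: A partial permutation of length $n$ with one hole is a sequence $\pi_1\cdots\pi_n$ in which each of $1,\dots,n-1$ appears exactly once and the remaining entry is a hole symbol $\diamond$. A permutation $\sigma$ of $[n]$ is an extension of $\pi$ if the standardization (order-preserving relabeling by $1,2,\dots$) of the restriction of $\sigma$ to the non-hole positions equals the restriction of $\pi$ to those positions. $\pi$ avoids a pattern $p$ if every extension of $\pi$ avoids $p$ in the classical sense. *)

(* Defs.v *)
From mathcomp Require Import all_boot all_order all_fingroup all_algebra.

Set Implicit Arguments.
Unset Strict Implicit.
Unset Printing Implicit Defensive.

(* For a sequence of distinct entries, the number of entries that are at most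
   x is the rank of x, counted from 1. *)
Definition std (s : seq nat) : seq nat :=
  [seq count (fun y => y <= x) s | x <- s].

(* One-line notation with values in {1, ..., n}: 'S_n permutes {0, ..., n-1}. *)
Definition perm_word (n : nat) (sigma : 'S_n) : seq nat :=
  [seq (val (sigma i)).+1 | i <- enum 'I_n].

(* p is the one-line notation, with values from 1, of the pattern. *)
Definition contains (s p : seq nat) : bool :=
  [exists m : (size s).-tuple bool, std (mask m s) == p].

(* The hole is None. The letters are 1-based: Some v stands for the number v,
   and the counting conditions leave no position for Some 0. *)
Definition is_partial_perm1 (n : nat) (pi : n.-tuple (option 'I_n)) : bool :=
  (count_mem None pi == 1) &&
  [forall v : 'I_n, (0 < v) ==> (count_mem (Some v) pi == 1)].

Definition is_extension (n : nat) (pi : n.-tuple (option 'I_n))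
    (sigma : 'S_n) : bool :=
  std (mask [seq isSome x | x <- pi] (perm_word sigma))
    == [seq val v | v <- pmap id pi].

Definition pavoids (n : nat) (pi : n.-tuple (option 'I_n)) (p : seq nat)
    : bool :=
  [forall sigma : 'S_n,
     is_extension pi sigma ==> ~~ contains (perm_word sigma) p].

Definition s1 (n : nat) (p : seq nat) : nat :=
  #|[set pi : n.-tuple (option 'I_n) | is_partial_perm1 pi && pavoids pi p]|.

(* Main.v *)
Require Import Defs.
From mathcomp Require Import all_boot all_order all_fingroup all_algebra.
From mathcomp Require Import ring lra zify.

(* Cut a partial permutation at its hole into a word p before and a word q
   after it, on the values 1, ..., N (N = n - 1).  All extensions avoid 2413
   exactly when p avoids 231, q avoids 312, no letter of q lies strictly between
   the two letters of an ascending pair of p, and no letter of p lies strictly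
   between the two letters of an ascending pair of q.  For a fixed partition of
   the values between p and q, read as a Boolean word from the value N downwards,
   these conditions split into one on p and one on q.  They force the letters of
   p above the lowest run of p-values to come first, in decreasing order, and
   leave an arbitrary 231-avoider on that run; hence p can be chosen in Catalan
   many ways, and q is symmetric under reversal and complementation.  Summing the
   products of two Catalan numbers over all Boolean words gives
   2 C_(N+1) - 2^N. *)

Set Implicit Arguments.
Unset Strict Implicit.
Unset Printing Implicit Defensive.

Import GRing.Theory Num.Theory.
Local Open Scope ring_scope.

(** * Catalan numbers and weighted words *)

Definition catalan (n : nat) : rat := 'C(2 * n, n)%:R / n.+1%:R.

Lemma catalan0 : catalan 0 = 1.
Proof. by rewrite /catalan bin0 divr1. Qed.

Lemma central_binS n :
  n.+1%:R * 'C(2 * n.+1, n.+1)%:R = 2 * (2 * n%:R + 1) * 'C(2 * n, n)%:R :> rat.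
Proof.
have e1 : (n.+1 * 'C(2 * n.+1, n.+1) = (2 * n.+1) * 'C((2 * n).+1, n))%N.
  by rewrite -mul_bin_diag mulnS.
have e2 : (n.+1 * 'C((2 * n).+1, n) = (2 * n).+1 * 'C(2 * n, n))%N.
  have := mul_bin_down (2 * n).+1 n; rewrite /=.
  by have -> : ((2 * n).+1 - n = n.+1)%N by lia.
by rewrite -[in LHS]natrM e1 -mulnA e2 -[(2 * n).+1]addn1 !natrM natrD natrM; ring.
Qed.

Lemma catalan1 : catalan 1 = 1.
Proof. by rewrite /catalan (_ : 'C(2 * 1, 1) = 2)%N // divff. Qed.

(* Gosper's telescoping certificate for the Catalan convolution *)
Definition gosper (n j : nat) : rat :=
  'C(2 * j, j)%:R * 'C(2 * (n - j), n - j)%:R * (2 * j%:R - n%:R)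
    / (2 * n%:R * n.+1%:R).

Lemma gosperB n j : (j <= n)%N ->
  gosper n.+1 j.+1 - gosper n.+1 j = catalan j * catalan (n - j).
Proof.
move=> hj; rewrite /gosper /catalan subSS.
(* Writing [n] as [j + k] removes the truncated subtractions. Both sides are then rational multiples
   of the same product of two central binomials, and [field] compares the factors. *)
have [k ->] : exists k, n = (j + k)%N by exists (n - j)%N; lia.
have -> : ((j + k).+1 - j = k.+1)%N by lia.
have -> : (j + k - j = k)%N by lia.
have hS m : 'C(2 * m.+1, m.+1)%:R
     = 2 * (2 * m%:R + 1) * 'C(2 * m, m)%:R / m.+1%:R :> rat.
  by rewrite -central_binS mulrC mulKf // pnatr_eq0.
rewrite !hS -!natr1 natrD.
have hj0 : 0 <= j%:R :> rat by apply: ler0n.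
have hk0 : 0 <= k%:R :> rat by apply: ler0n.
by field; rewrite ?andbT; repeat (apply/andP; split); apply/lt0r_neq0; lra.
Qed.

(** The convolution telescopes through [gosper]. Its values at the two ends are opposite, each half
    of [catalan n.+1] up to sign. *)
Lemma catalanS n : catalan n.+1 = \sum_(i < n.+1) catalan i * catalan (n - i).
Proof.
rewrite -(big_mkord predT (fun i => catalan i * catalan (n - i))).
rewrite (eq_big_nat _ _ (F2 := fun i => gosper n.+1 i.+1 - gosper n.+1 i)); last first.
  by move=> i /andP[_ hi]; rewrite gosperB.
rewrite telescope_sumr // /gosper subnn subn0 muln0 bin0 /catalan.
have hn0 : 0 <= n%:R :> rat by apply: ler0n.
rewrite -!natr1.
by field; repeat (apply/andP; split); apply/lt0r_neq0; lra.
Qed.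

(** This is the recurrence for [catalan n.+2] without its first and last terms, both equal to
    [catalan n.+1]. *)
Lemma sum_catalan_inner n :
  \sum_(i < n) catalan i.+1 * catalan (n - i) = catalan n.+2 - 2 * catalan n.+1.
Proof.
rewrite (catalanS n.+1) big_ord_recl big_ord_recr /= subn0 subnn catalan0.
under [in RHS]eq_bigr => i _ do rewrite /= /bump leq0n add1n subSS.
by ring.
Qed.

(** * Boolean words and the sums of their weights *)

(** Words made of letters true followed by letters false. Read from the largest value down, they put
    every marked value above every unmarked one. *)
Fixpoint desc (w : bitseq) : bool :=
  if w is b :: w' then if b then desc w' else ~~ has id w' else true.

(* The Catalan number indexed by the length of the last run of letters true. *)
Fixpoint wt (w : bitseq) : rat :=
  if w is _ :: w' then if desc w then catalan (count id w) else wt w' else 1.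

(** Complementing the values reverses the word, and exchanging the two sides of the hole negates it.
    Hence [flip w] plays for q the role that [w] plays for p. *)
Definition flip (w : bitseq) : bitseq := rev (map negb w).

Fixpoint words (n : nat) : seq bitseq :=
  if n is m.+1 then map (cons true) (words m) ++ map (cons false) (words m)
  else [:: [::]].

Lemma mem_words n w : (w \in words n) = (size w == n).
Proof.
elim: n w => [|n IH] [|b w] //=; rewrite mem_cat.
  by apply/negP => /orP[] /mapP[].
have hb c : (b :: w \in map (cons c) (words n)) = (b == c) && (size w == n).
  apply/mapP/andP => [[u hu [-> ->]]|[/eqP-> hw]]; first by rewrite -IH.
  by exists w; rewrite ?IH.
by rewrite !hb eqSS; case: (b); rewrite ?orbF.
Qed.

Lemma words_uniq n : uniq (words n).
Proof.
elim: n => //= n IH; rewrite cat_uniq !map_inj_uniq ?IH ?andbT //=; try by move=> u v [].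
by apply/hasPn => _ /mapP[u _ ->]; apply/mapP => -[].
Qed.

Lemma wt_desc w : desc w -> wt w = catalan (count id w).
Proof. by case: w => [|b w] /=; [rewrite catalan0 | move=> ->]. Qed.

Lemma wt_not_desc b w : ~~ desc (b :: w) -> wt (b :: w) = wt w.
Proof. by move=> /= /negPf->. Qed.

Lemma no_true_desc w : ~~ has id w -> desc w.
Proof. by case: w => //= -[]. Qed.

Lemma wt_false w : wt (false :: w) = wt w.
Proof.
by rewrite /=; case: ifPn => // h; rewrite wt_desc // no_true_desc.
Qed.

Lemma wt_rcons_false w : wt (rcons w false) = wt w.
Proof.
have hd u : desc (rcons u false) = desc u.
  by elim: u => // b u IH; rewrite rcons_cons /= IH has_rcons.
elim: w => [|b w IH]; first by rewrite /= catalan0.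
by rewrite rcons_cons /= IH hd has_rcons -cats1 count_cat /= !addn0.
Qed.

Lemma wt_last_run v j : wt (v ++ false :: nseq j.+1 true) = catalan j.+1.
Proof.
have hd u : desc (u ++ false :: nseq j.+1 true) = false.
  by elim: u => //= b u ->; rewrite has_cat /= !orbT; case: b.
elim: v => [|b v IH].
  rewrite cat0s wt_false wt_desc ?count_nseq ?mul1n //.
  by elim: j.+1.
have -> : (b :: v) ++ false :: nseq j.+1 true = b :: (v ++ false :: nseq j.+1 true) by [].
by rewrite -IH /= -[if b then _ else _]/(desc (b :: _)) -cat_cons hd.
Qed.

Lemma flip_cons b w : flip (b :: w) = rcons (flip w) (~~ b).
Proof. by rewrite /flip /= rev_cons. Qed.

Lemma sum_words_no_true n (f : bitseq -> rat) :
  \sum_(w <- words n | ~~ has id w) f w = f (nseq n false).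
Proof.
elim: n f => [|n IH] f /=; first by rewrite big_cons big_nil addr0.
by rewrite big_cat !big_map /= big_pred0_eq add0r IH.
Qed.

Lemma sum_words_desc n (f : bitseq -> rat) :
  \sum_(w <- words n | desc w) f w
    = \sum_(k < n.+1) f (nseq k true ++ nseq (n - k) false).
Proof.
elim: n f => [|n IH] f.
  by rewrite /= big_cons big_nil big_ord1 addr0.
rewrite /= big_cat !big_map /= IH sum_words_no_true addrC [in RHS]big_ord_recl subn0.
by congr (_ + _); apply: eq_bigr => i _; rewrite /= /bump leq0n add1n subSS.
Qed.

Lemma sum_words_true n (f : bitseq -> rat) :
  \sum_(w <- words n | has id w) f w
    = \sum_(j < n) \sum_(u <- words (n - j.+1)) f (nseq j false ++ true :: u).
Proof.
elim: n f => [|n IH] f; first by rewrite /= big_cons big_nil big_ord0.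
rewrite /= big_cat !big_map /= IH big_ord_recl subn1.
by congr (_ + _); apply: eq_bigr => i _; rewrite /= /bump leq0n add1n subSS.
Qed.

Definition sum_wt n := \sum_(w <- words n) wt w.
Definition sum_wt_true n := \sum_(w <- words n) wt (true :: w).

Lemma sum_wtS n : sum_wt n.+1 = sum_wt_true n + sum_wt n.
Proof.
rewrite /sum_wt /= big_cat !big_map; congr (_ + _).
by apply: eq_bigr => w _; rewrite wt_false.
Qed.

(** A leading true changes only the weight of the [desc] words, from C_k to C_(k+1), with one such
    word for each k. These differences telescope to C_(n+1) - C_0. *)
Lemma sum_wt_trueE n : sum_wt_true n = sum_wt n + catalan n.+1 - 1.
Proof.
rewrite /sum_wt_true /sum_wt (bigID desc) [in RHS](bigID desc) /=.
have hk k : count id (nseq k true ++ nseq (n - k) false) = k.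
  by rewrite count_cat !count_nseq mul1n addn0.
have -> : \sum_(w <- words n | desc w) wt w = \sum_(k < n.+1) catalan k.
  rewrite (eq_bigr (fun w => catalan (count id w))) => [|w]; last exact: wt_desc.
  by rewrite sum_words_desc; apply: eq_bigr => k _; rewrite hk.
rewrite (eq_bigr (fun w => catalan (count id w).+1)) => [|w -> //].
rewrite [X in _ + X = _](eq_bigr wt) => [|w /negPf-> //].
rewrite sum_words_desc (eq_bigr (fun k : 'I_n.+1 => catalan k.+1)); last first.
  by move=> k _; rewrite hk.
rewrite big_ord_recr [in RHS]big_ord_recl /= catalan0.
under [in RHS]eq_bigr => i _ do rewrite /bump leq0n add1n.
by ring.
Qed.

Lemma sum_wt_trueS n :
  sum_wt_true n.+1 = 2 * sum_wt_true n + catalan n.+2 - catalan n.+1.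
Proof. by rewrite [LHS]sum_wt_trueE sum_wtS sum_wt_trueE; ring. Qed.

Lemma sum_catalan_wt n :
  \sum_(j < n) catalan j.+1 * sum_wt_true (n - j.+1)
    = catalan n.+2 - catalan n.+1 - 2 ^+ n.
Proof.
have c2 : catalan 2 = 2 by rewrite catalanS !big_ord_recl big_ord0 catalan1 catalan0.
elim: n => [|n IH].
  by rewrite big_ord0 c2 catalan1.
rewrite big_ord_recr /= subnn.
have -> : sum_wt_true 0 = 1.
  by rewrite /sum_wt_true /= big_cons big_nil /= catalan1 addr0.
(* Applying [sum_wt_trueS] to every term but the last doubles the sum of the induction hypothesis
   and leaves two Catalan convolutions. *)
rewrite (eq_bigr (fun j : 'I_n => 2 * (catalan j.+1 * sum_wt_true (n - j.+1))
   + (catalan j.+1 * catalan (n.+1 - j) - catalan j.+1 * catalan (n - j)))); last first.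
  move=> j _; have hj := ltn_ord j; rewrite subSS -[(n - j)%N]prednK ?subn_gt0 //.
  rewrite sum_wt_trueS -subnS.
  have -> : ((n - j.+1).+2 = n.+1 - j)%N by lia.
  have -> : ((n - j.+1).+1 = n - j)%N by lia.
  by ring.
rewrite big_split /= -mulr_sumr IH sumrB sum_catalan_inner.
(* The first convolution is [sum_catalan_inner n.+1] short of its last term
   [catalan n.+1 * catalan 1]. *)
have := sum_catalan_inner n.+1; rewrite big_ord_recr /= subSnn catalan1 => h.
have -> : \sum_(i < n) catalan i.+1 * catalan (n.+1 - i)
   = catalan n.+3 - 2 * catalan n.+2 - catalan n.+1 by rewrite -h; ring.
by rewrite exprS; ring.
Qed.

Lemma sum_words_wt n :
  \sum_(w <- words n) wt w * wt (flip w) = 2 * catalan n.+1 - 2 ^+ n.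
Proof.
rewrite (bigID desc) /=.
(* A [desc] word with k letters true flips to a [desc] word with n - k letters true, so this part is
   the Catalan convolution. *)
have -> : \sum_(w <- words n | desc w) wt w * wt (flip w) = catalan n.+1.
  rewrite sum_words_desc catalanS; apply: eq_bigr => k _.
  have hd i j : desc (nseq i true ++ nseq j false).
    by elim: i => //=; case: j => //= j; rewrite has_nseq andbF.
  have hc i j : count id (nseq i true ++ nseq j false) = i.
    by rewrite count_cat !count_nseq mul1n addn0.
  by rewrite /flip map_cat !map_nseq rev_cat !rev_nseq !wt_desc // !hc.
suff -> : \sum_(w <- words n | ~~ desc w) wt w * wt (flip w) = catalan n.+1 - 2 ^+ n.
  by ring.
elim: n => [|n IH].
  by rewrite /= big_cons big_nil /= catalan1.
rewrite [words _]/= big_cat !big_map /=.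
(* A leading true on a word that is not [desc] preserves both weights: the word stays outside
   [desc], and its flip only gains a final false. The induction hypothesis covers these words. *)
have -> : \sum_(w <- words n | ~~ desc w)
    (if desc w then catalan (1 + count id w) else wt w) * wt (flip (true :: w))
   = catalan n.+1 - 2 ^+ n.
  rewrite -IH; apply: eq_bigr => w /negPf->.
  by rewrite flip_cons wt_rcons_false.
have -> : \sum_(w <- words n | ~~ ~~ has id w)
    (if ~~ has id w then catalan (0 + count id w) else wt w) * wt (flip (false :: w))
   = \sum_(w <- words n | has id w) wt w * wt (flip (false :: w)).
  by rewrite (eq_bigl (has id)) => [|w]; [apply: eq_bigr => w -> | rewrite negbK].
(* Words with a leading false are split at their first true, after j + 1 letters false. The flip
   then ends in a false followed by j + 1 letters true and weighs C_(j+1), while the leading letters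
   false do not affect the weight of the word itself. *)
rewrite sum_words_true.
rewrite (eq_bigr (fun j : 'I_n => catalan j.+1 * sum_wt_true (n - j.+1))).
  by rewrite sum_catalan_wt exprS; ring.
move=> j _; rewrite /sum_wt_true mulr_sumr; apply: eq_bigr => u _.
have -> : wt (nseq j false ++ true :: u) = wt (true :: u).
  by elim: (val j) => // k IHk; rewrite -IHk -[RHS]wt_false.
rewrite mulrC; congr (_ * _).
rewrite -[false :: _]/(nseq j.+1 false ++ true :: u) /flip map_cat map_nseq.
by rewrite rev_cat rev_nseq map_cons rev_cons -cats1 -catA wt_last_run.
Qed.

Local Open Scope nat_scope.

(** * Enumerating 231-avoiding arrangements *)

Fixpoint triplewise (T : Type) (r : T -> T -> T -> bool) (s : seq T) : bool :=
  if s is x :: s' then pairwise (r x) s' && triplewise r s' else true.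

Lemma triplewise_cat (T : Type) (r : T -> T -> T -> bool) s t :
  triplewise r (s ++ t) =
    [&& triplewise r s, triplewise r t, all (fun x => pairwise (r x) t) s
      & all (fun z => pairwise (fun x y => r x y z) s) t].
Proof.
elim: s => [|x s IH] /=; first by rewrite all_predT andbT.
rewrite {}IH pairwise_cat allrelC [allrel _ t s]/allrel.
have -> : all (fun z => all (r x ^~ z) s && pairwise (fun x0 y => r x0 y z) s) t
  = all (fun z => all (r x ^~ z) s) t && all (fun z => pairwise (fun x0 y => r x0 y z) s) t.
  by rewrite -all_predI.
case: (pairwise (r x) s); case: (pairwise (r x) t); case: (triplewise r s);
  case: (triplewise r t); rewrite /= ?andbF ?andbT //.
by rewrite andbCA.
Qed.

Lemma triplewise_map (T U : Type) (f : U -> T) (r : T -> T -> T -> bool) s :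
  triplewise r (map f s) = triplewise (fun x y z => r (f x) (f y) (f z)) s.
Proof. by elim: s => //= x s ->; rewrite pairwise_map. Qed.

Lemma pairwise_rev (T : Type) (r : rel T) s :
  pairwise r (rev s) = pairwise (fun x y => r y x) s.
Proof.
by elim: s => //= x s IH; rewrite rev_cons pairwise_rcons IH all_rev.
Qed.

Lemma triplewise_rev (T : Type) (r : T -> T -> T -> bool) s :
  triplewise r (rev s) = triplewise (fun x y z => r z y x) s.
Proof.
elim: s => //= x s IH; rewrite rev_cons -cats1 triplewise_cat /= IH pairwise_rev.
by rewrite all_predT !andbT andbC.
Qed.

Lemma eq_in_triplewise (T : Type) (P : {pred T}) (r r' : T -> T -> T -> bool) s :
  (forall x y z, x \in P -> y \in P -> z \in P -> r x y z = r' x y z) ->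
  all [in P] s -> triplewise r s = triplewise r' s.
Proof.
move=> hr; elim: s => //= x s IH /andP[hx hs]; rewrite IH //; congr (_ && _).
by apply: (eq_in_pairwise _ hs) => y z hy hz; apply: hr.
Qed.

Definition avoid231 : pred (seq nat) :=
  triplewise (fun x y z => ~~ ((z < x) && (x < y))).

Definition avoid312 : pred (seq nat) :=
  triplewise (fun x y z => ~~ ((y < z) && (z < x))).

Definition no_jump (c : nat) : pred (seq nat) :=
  pairwise (fun y z => ~~ ((y < c) && (c < z))).

(** The maximum [x] completes a 231 with any letter of [L] and a smaller letter of [R], which forces
    the comparison of the sides. Conversely, that comparison excludes every occurrence of 231 that
    is not inside one side. *)
Lemma avoid231_max L x R : all (gtn x) L -> all (gtn x) R ->
  avoid231 (L ++ x :: R) = [&& avoid231 L, avoid231 R & allrel leq L R].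
Proof.
move=> /allP hL' /allP hR'.
have hL a : a \in L -> a < x := hL' a.
have hR a : a \in R -> a < x := hR' a.
rewrite /avoid231 triplewise_cat.
apply/and4P/and3P => [[h1 /= /andP[_ h2] /allP h3 _]|[h1 h2 /allrelP h3]].
  split=> //; apply/allrelP => a c ha hc; move: (h3 a ha) => /= /andP[/allP h _].
  by move: (h c hc); rewrite (hL a ha) andbT -leqNgt.
have hp (r : rel nat) s : (forall a b, a \in s -> b \in s -> r a b) -> pairwise r s.
  elim: s => //= a s IH h; apply/andP; split.
    by apply/allP => b hb; apply: h; rewrite inE ?eqxx ?hb ?orbT.
  by apply: IH => u v hu hv; apply: h; rewrite inE ?hu ?hv orbT.
split=> //.
- rewrite /= h2 andbT; apply: hp => a b ha _.
  by rewrite negb_and -!leqNgt (ltnW (hR a ha)) orbT.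
- apply/allP => a ha; apply: hp => b c _ hc; rewrite negb_and -leqNgt.
  move: hc; rewrite inE => /predU1P[->|hc]; last by rewrite h3.
  by rewrite ltnW // hL.
- apply/allP => c hc /=; apply: hp => a b ha _; rewrite negb_and -leqNgt.
  move: hc; rewrite inE => /predU1P[->|hc]; last by rewrite h3.
  by rewrite ltnW // hL.
Qed.

(** Sorting [R] and [L] separately in decreasing order and concatenating gives a sorted list, which
    must be [s]. The size of [R] thus determines the contents of both parts. *)
Lemma perm_cat_desc L R s : pairwise gtn s -> perm_eq (L ++ R) s -> allrel leq L R ->
  perm_eq R (take (size R) s) /\ perm_eq L (drop (size R) s).
Proof.
move=> hs hp hLR.
have hso : sorted geq (sort geq R ++ sort geq L).
  rewrite sorted_pairwise; last by move=> y x z /= h1 h2; exact: leq_trans h2 h1.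
  have tot : total geq by move=> x y; exact: leq_total.
  have tr : transitive geq by move=> y x z /= h1 h2; exact: leq_trans h2 h1.
  rewrite pairwise_cat -!sorted_pairwise // !sort_sorted // !andbT.
  by apply/allrelP => x y; rewrite !mem_sort => hx hy; exact: (allrelP hLR).
have -> : s = sort geq R ++ sort geq L.
  apply: (@sorted_eq _ geq) => //.
  - by move=> y x z /= h1 h2; exact: leq_trans h2 h1.
  - by move=> x y /= /anti_leq.
  - apply: pairwise_sorted; apply: sub_pairwise hs => x y /=; exact: ltnW.
  - rewrite -(permPl hp) perm_catC perm_sym.
    by apply: perm_cat; rewrite perm_sort.
rewrite -(size_sort geq R) take_size_cat // drop_size_cat //.
by split; rewrite perm_sym perm_sort.
Qed.

(** Here [m] is fuel and [s] is meant to be decreasing, so that its head is the maximum. The index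
    [k] counts the letters placed after the maximum, which must be the [k] largest of the others. *)
Fixpoint enum231 (m : nat) (s : seq nat) : seq (seq nat) :=
  if m is m'.+1 then
    if s is x :: s' then
      [seq y | k <- iota 0 (size s),
               y <- [seq L ++ x :: R | L <- enum231 m' (drop k s'),
                                       R <- enum231 m' (take k s')]]
    else [:: [::]]
  else [:: [::]].

Lemma enum231S m x s : enum231 m.+1 (x :: s) =
  [seq y | k <- iota 0 (size s).+1,
           y <- [seq L ++ x :: R | L <- enum231 m (drop k s),
                                   R <- enum231 m (take k s)]].
Proof. by []. Qed.

Lemma union_uniq (K T : eqType) (ks : seq K) (F : K -> seq T) : uniq ks ->
  (forall k, k \in ks -> uniq (F k)) ->
  (forall k l y, k \in ks -> l \in ks -> y \in F k -> y \in F l -> k = l) ->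
  uniq [seq y | k <- ks, y <- F k].
Proof.
elim: ks => //= k ks IH /andP[hk hks] hF hd.
rewrite map_id cat_uniq hF ?mem_head // IH //=; first last.
- by move=> a b y ha hb; apply: hd; rewrite inE ?ha ?hb orbT.
- by move=> a ha; apply: hF; rewrite inE ha orbT.
rewrite andbT; apply/hasPn => y /allpairsPdep[l [z [hl hz ->]]].
apply/negP => hy; move: hk.
by rewrite (hd k l z) ?mem_head ?inE ?hl ?orbT.
Qed.

Lemma perm_insert (T : eqType) (x : T) L R s :
  perm_eq (L ++ x :: R) (x :: s) = perm_eq (L ++ R) s.
Proof. by rewrite -cat1s perm_catCA perm_cons. Qed.

Lemma mem_enum231 m s p : size s <= m -> pairwise gtn s ->
  (p \in enum231 m s) = perm_eq p s && avoid231 p.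
Proof.
have nilE (q : seq nat) : (q \in [:: [::]]) = perm_eq q [::] && avoid231 q.
  by rewrite inE; apply/eqP/andP => [-> //|[/perm_nilP]].
elim: m s p => [|m IH] [|x s] p // hs; rewrite pairwise_cons => /andP[hx hp].
have sub k : (size (take k s) <= m) /\ (size (drop k s) <= m).
  by move: hs => /=; rewrite size_take_min size_drop; lia.
have hpt k : pairwise gtn (take k s) by apply: subseq_pairwise hp; exact: take_subseq.
have hpd k : pairwise gtn (drop k s) by apply: subseq_pairwise hp; exact: drop_subseq.
have max L R : perm_eq (L ++ R) s -> all (gtn x) L /\ all (gtn x) R.
  by move=> h; apply/andP; rewrite -all_cat (perm_all _ h).
rewrite enum231S.
apply/allpairsPdep/andP => [[k [_ [_ /allpairsP[[L R] [/= hL hR ->]] ->]]]|[hq hav]].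
  move: hL hR; rewrite !IH //; try by case: (sub k).
  move=> /andP[hL aL] /andP[hR aR].
  have hLR : perm_eq (L ++ R) s.
    by rewrite perm_catC -[s in perm_eq _ s](cat_take_drop k); exact: perm_cat.
  rewrite perm_insert; split=> //.
  have [mL mR] := max _ _ hLR.
  rewrite avoid231_max // aL aR /=; apply/allrelP => a c.
  rewrite (perm_mem hL) (perm_mem hR) => ha hc.
  move: hp; rewrite -(cat_take_drop k s) pairwise_cat => /andP[/allrelP h _].
  by apply: ltnW; apply: (h c a).
(* Conversely, [p] is cut at its maximum [x], and the index [k] is the size of the right part. *)
have hxp : x \in p by rewrite (perm_mem hq) mem_head.
case/splitPr: hxp hq hav => L R; rewrite perm_insert => hLR.
have [mL mR] := max _ _ hLR.
rewrite avoid231_max // => /and3P[aL aR hrel].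
have [pR pL] := perm_cat_desc hp hLR hrel.
exists (size R), (L ++ x :: R); split=> //.
  by rewrite mem_iota /= add0n ltnS -(perm_size hLR) size_cat leq_addl.
have [h1 h2] := sub (size R).
by apply/allpairsP; exists (L, R); rewrite /= !IH // pL pR aL aR.
Qed.

Lemma enum231_uniq m s : size s <= m -> pairwise gtn s -> uniq (enum231 m s).
Proof.
elim: m s => [|m IH] [|x s] // hs hsp; have /andP[hx hp] := hsp.
have sub k : (size (take k s) <= m) /\ (size (drop k s) <= m).
  by move: hs => /=; rewrite size_take_min size_drop; lia.
have hpt k : pairwise gtn (take k s) by apply: subseq_pairwise hp; exact: take_subseq.
have hpd k : pairwise gtn (drop k s) by apply: subseq_pairwise hp; exact: drop_subseq.
have notin k : x \notin drop k s.
  by apply/negP => /mem_drop; move/allP: hx => /[apply] /=; rewrite ltnn.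
(* Since [x] does not occur in the left part, its index in the word is the size of that part, so the
   word determines both parts. *)
have inj k l L R L' R' : L \in enum231 m (drop k s) -> L' \in enum231 m (drop l s) ->
    L ++ x :: R = L' ++ x :: R' -> L = L' /\ R = R'.
  rewrite !mem_enum231 //; try by [case: (sub k) | case: (sub l)].
  move=> /andP[hL _] /andP[hL' _] e.
  have iL : index x (L ++ x :: R) = size L.
    by rewrite index_cat (perm_mem hL) (negPf (notin k)) /= eqxx addn0.
  have iL' : index x (L' ++ x :: R') = size L'.
    by rewrite index_cat (perm_mem hL') (negPf (notin l)) /= eqxx addn0.
  have es : size L = size L' by rewrite -iL -iL' e.
  by move/eqP: e; rewrite eqseq_cat // => /andP[/eqP-> /eqP[->]].
rewrite enum231S; apply: union_uniq => [|k hk|k l y].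
- exact: iota_uniq.
- apply: allpairs_uniq; try by apply: IH; case: (sub k).
  move=> _ _ /allpairsP[[L R] [/= hL _ ->]] /allpairsP[[L' R'] [/= hL' _ ->]] /= e.
  by have [-> ->] := inj _ _ _ _ _ _ hL hL' e.
- rewrite !mem_iota !add0n /= !ltnS => hk hl.
  move=> /allpairsP[[L R] [/= hL hR ->]] /allpairsP[[L' R'] [/= hL' hR' e]].
  have [_ eR] := inj _ _ _ _ _ _ hL hL' e.
  (* The index [k] is recovered as the size of the right part. *)
  move: hR hR'; rewrite !mem_enum231 //; try by [case: (sub k) | case: (sub l)].
  rewrite eR => /andP[/perm_size + _] /andP[/perm_size + _].
  by rewrite !size_take_min => ->; rewrite (minn_idPl hk) (minn_idPl hl).
Qed.

(** Placing [k] letters after the maximum gives the product of Catalan numbers in the recurrence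
    [catalanS]. *)
Lemma size_enum231 m s : size s <= m ->
  ((size (enum231 m s))%:R = catalan (size s) :> rat)%R.
Proof.
elim: m s => [|m IH] [|x s] hs; rewrite ?catalan0 //.
rewrite enum231S size_allpairs_dep sumnE big_map.
rewrite -{1}[(size s).+1]subn0 -/(index_iota 0 (size s).+1) natr_sum big_nat.
rewrite [size (x :: s)]/= catalanS.
rewrite -(big_mkord predT (fun i => catalan i * catalan (size s - i))%R).
rewrite [RHS]big_nat; apply: eq_bigr => k /= hk.
move: hs => /= hs.
rewrite size_allpairs natrM !IH ?size_take_min ?size_drop; try lia.
rewrite (minn_idPl _); last by lia.
by rewrite mulrC.
Qed.

(** * Arrangements of one side compatible with the letters of the other *)

Definition fits231 (B p : seq nat) : bool :=
  avoid231 p && all (fun c => no_jump c p) B.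

Definition fits312 (A q : seq nat) : bool :=
  avoid312 q && all (fun a => no_jump a q) A.

(* [s] lists the values from the largest down; [w] marks those to be arranged. *)
Fixpoint enum_fits (w : bitseq) (s : seq nat) : seq (seq nat) :=
  match w, s with
  | b :: w', x :: s' =>
      if desc w then enum231 (size s) (mask w s)
      else if b then map (cons x) (enum_fits w' s') else enum_fits w' s'
  | _, _ => [:: [::]]
  end.

Lemma enum_fits_cons b w x s : enum_fits (b :: w) (x :: s) =
  if desc (b :: w) then enum231 (size (x :: s)) (mask (b :: w) (x :: s))
  else if b then map (cons x) (enum_fits w s) else enum_fits w s.
Proof. by []. Qed.

Lemma mask_no_true (T : Type) w (s : seq T) : ~~ has id w -> mask w s = [::].
Proof. by elim: w s => [|[] w IH] [|x s] //=; exact: IH. Qed.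

Lemma desc_mask w s : desc w -> pairwise gtn s ->
  allrel gtn (mask w s) (mask (map negb w) s).
Proof.
elim: w s => [|[] w IH] [|x s] //= hw /andP[hx hs].
  by rewrite allrel_consl IH // andbT all_mask.
by rewrite mask_no_true.
Qed.

(** Supplies the pair that [fits231_max_first] needs in order to force the maximum into first
    place. *)
Lemma not_desc_mask w s : ~~ desc w -> size w = size s -> pairwise gtn s ->
  exists c a, [/\ c \in mask (map negb w) s, a \in mask w s & a < c].
Proof.
elim: w s => [|[] w IH] [|x s] //= hw [sz] /andP[/allP hx hs].
  have [c [a [hc ha hac]]] := IH s hw sz hs.
  by exists c, a; rewrite hc inE ha orbT.
move: hw; rewrite negbK has_count -(size_mask sz).
case e : (mask w s) => [//|a t] _; exists x, a; rewrite !mem_head; split=> //.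
by apply: (hx a); apply: (@mem_mask _ _ w); rewrite e mem_head.
Qed.

Lemma no_jump_side c p : all (gtn c) p || all (ltn c) p -> no_jump c p.
Proof.
move=> h; rewrite /no_jump; elim: p h => //= x p IH h; apply/andP; split.
  apply/allP => y hy; case/orP: h => /andP[/= hx /allP h].
    by rewrite negb_and -!leqNgt (ltnW (h y hy : y < c)) orbT.
  by rewrite negb_and -!leqNgt (ltnW hx).
by apply: IH; case/orP: h => /andP[_ ->]; rewrite ?orbT.
Qed.

(** A maximum in first position starts no ascending pair, so it creates neither a 231 nor a jump. *)
Lemma fits231_max x B p : all (gtn x) p -> all (gtn x) B ->
  fits231 B (x :: p) = fits231 B p.
Proof.
move=> hp /allP hB; rewrite /fits231 -[x :: p]/([::] ++ x :: p) avoid231_max //=.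
rewrite allrel0l andbT; congr (_ && _); apply: eq_in_all => c hc.
rewrite /no_jump /= andb_idl // => _; apply/allP => y hy.
by rewrite negb_and -!leqNgt (ltnW (hB c hc : c < x)).
Qed.

(** A letter before [x] that is below [c] would jump over [c] with [x], so all letters before [x]
    are at least [c]. Hence [a] comes after [x], and avoidance of 231 bounds every letter before [x]
    by [a], which is less than [c]. No letter can then precede [x]. *)
Lemma fits231_max_first x A B p c a : all (gtn x) A -> perm_eq p (x :: A) ->
  all (gtn x) B -> c \in B -> a \in A -> a < c -> fits231 B p ->
  exists2 q, p = x :: q & perm_eq q A.
Proof.
move=> hA hp /allP hB hc ha hac.
have hx : x \in p by rewrite (perm_mem hp) mem_head.
case/splitPr: hx hp => L R; rewrite perm_insert => hp /andP[].
have /andP[hL hR] : all (gtn x) L && all (gtn x) R by rewrite -all_cat (perm_all _ hp).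
rewrite avoid231_max // => /and3P[_ _ /allrelP hLR] /allP /(_ c hc).
rewrite /no_jump pairwise_cat => /andP[/allrelP hj _].
have hcL z : z \in L -> c <= z.
  move=> hz; move: (hj z x hz (mem_head _ _)).
  by rewrite (hB c hc : c < x) andbT -leqNgt.
have haR : a \in R.
  move: ha; rewrite -(perm_mem hp) mem_cat => /orP[/hcL|//].
  by rewrite leqNgt hac.
case: L hp hLR hcL {hL hj} => [|z L] hp hLR hcL; first by exists R.
have := leq_ltn_trans (hLR z a (mem_head _ _) haR) hac.
by rewrite ltnNge hcL ?mem_head.
Qed.

Lemma mem_enum_fits w s p : size w = size s -> pairwise gtn s ->
  (p \in enum_fits w s) = perm_eq p (mask w s) && fits231 (mask (map negb w) s) p.
Proof.
elim: w s p => [|b w IH] [|x s] p //.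
  by move=> _ _; rewrite inE; apply/eqP/andP => [-> //|[/perm_nilP]].
move=> hsz hp; rewrite enum_fits_cons; case: ifPn => hd.
  rewrite mem_enum231; last exact: pairwise_mask.
    (* Every letter of [p] exceeds every unmarked value, so only the avoidance of 231 remains. *)
    apply: andb_id2l => hpm; rewrite /fits231 andb_idr // => _.
    apply/allP => c hc; apply: no_jump_side; apply/orP; right.
    apply/allP => a; rewrite (perm_mem hpm) => ha.
    exact: (allrelP (desc_mask hd hp)).
  by rewrite size_mask // -hsz count_size.
move: hsz => [hsz]; move: hp hd; rewrite pairwise_cons => /andP[hx hp].
have hm m : all (gtn x) (mask m s) by exact: all_mask.
case: b => /= hd.
  apply/mapP/andP => [[q]|[hq hf]].
    rewrite IH // => /andP[hq hf] ->; rewrite perm_cons hq; split=> //.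
    by rewrite fits231_max // (perm_all _ hq).
  have [c [a [hc ha hac]]] := not_desc_mask hd hsz hp.
  have [q e hqA] := fits231_max_first (hm w) hq (hm _) hc ha hac hf.
  exists q => //; rewrite IH // hqA; move: hf; rewrite e fits231_max //.
  by rewrite (perm_all _ hqA).
(* The unmarked value [x] is above all of [p], so no pair jumps over it. *)
rewrite IH //; apply: andb_id2l => hpm; rewrite /fits231 /=.
by rewrite (no_jump_side (c := x)) // (perm_all _ hpm) hm.
Qed.

Lemma enum_fits_uniq w s : size w = size s -> pairwise gtn s -> uniq (enum_fits w s).
Proof.
elim: w s => [|b w IH] [|x s] // hsz hp; rewrite enum_fits_cons; case: ifPn => hd.
  apply: enum231_uniq; last exact: pairwise_mask.
  by rewrite size_mask // -hsz count_size.
move: hsz => [hsz]; move: hp; rewrite pairwise_cons => /andP[_ hp].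
by case: b {hd}; rewrite ?map_inj_uniq ?IH // => u v [].
Qed.

(** The recursion is that of [wt]: a forced first letter or a skipped value leaves the number of
    arrangements unchanged. *)
Lemma size_enum_fits w s : size w = size s ->
  ((size (enum_fits w s))%:R = wt w :> rat)%R.
Proof.
elim: w s => [|b w IH] [|x s] // hsz.
rewrite enum_fits_cons; move: (hsz) => [hsz'].
case: ifPn => hd.
  by rewrite wt_desc // size_enum231 size_mask // -hsz count_size.
by rewrite (wt_not_desc hd) -(IH s) //; case: (b); rewrite ?size_map.
Qed.

(** Reversal followed by complementation carries 312 to 231 and ascending pairs to ascending pairs.
    The bound by [N] makes the truncated subtraction strictly decreasing on the letters involved. *)
Lemma fits312_rev N A q : all (leq^~ N) A -> all (leq^~ N) q ->
  fits312 A q = fits231 (map (subn N) A) (rev (map (subn N) q)).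
Proof.
move=> hA hq; rewrite /fits312 /fits231; congr (_ && _).
  rewrite /avoid231 triplewise_rev triplewise_map.
  apply: (eq_in_triplewise _ hq) => x y z hx hy hz.
  have {}hx : x <= N := hx; have {}hy : y <= N := hy; have {}hz : z <= N := hz.
  by congr (~~ _); lia.
rewrite all_map; apply: eq_in_all => a ha /=.
rewrite /no_jump pairwise_rev pairwise_map; apply: (eq_in_pairwise _ hq) => x y hx hy /=.
have {}hx : x <= N := hx; have {}hy : y <= N := hy; have {}ha : a <= N := allP hA a ha.
by congr (~~ _); lia.
Qed.

(** * The words avoiding 2413 around a hole *)

Definition down (N : nat) : seq nat := rev (iota 1 N).

Lemma size_down N : size (down N) = N.
Proof. by rewrite size_rev size_iota. Qed.

Lemma mem_down N x : (x \in down N) = (0 < x <= N).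
Proof. by rewrite mem_rev mem_iota add1n ltnS. Qed.

Lemma down_pairwise N : pairwise gtn (down N).
Proof.
rewrite pairwise_rev -sorted_pairwise; last by move=> y x z; exact: ltn_trans.
exact: iota_ltn_sorted.
Qed.

Lemma down_uniq N : uniq (down N).
Proof. by rewrite rev_uniq iota_uniq. Qed.

Lemma perm_down N : perm_eq (down N) (iota 1 N).
Proof. by rewrite perm_rev. Qed.

Lemma rev_compl_down N : rev (map (subn N.+1) (down N)) = down N.
Proof.
rewrite /down map_rev; congr rev; apply: (@eq_from_nth _ 0).
  by rewrite size_rev size_map.
move=> i; rewrite size_rev size_map size_iota => hi.
rewrite nth_rev ?size_map ?size_iota // (nth_map 0) ?size_iota; last by lia.
by rewrite !nth_iota; lia.
Qed.

Definition enum312 (N : nat) (w : bitseq) : seq (seq nat) :=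
  [seq rev (map (subn N.+1) p) | p <- enum_fits (flip w) (down N)].

Lemma rev_complK N q : all (leq^~ N) q ->
  rev (map (subn N.+1) (rev (map (subn N.+1) q))) = q.
Proof.
move=> /allP hq; rewrite map_rev revK -map_comp map_id_in // => x /hq /= hx.
by rewrite subKn // ltnW.
Qed.

Lemma size_flip w : size (flip w) = size w.
Proof. by rewrite size_rev size_map. Qed.

Lemma mem_enum312 N w q : size w = N ->
  (q \in enum312 N w)
    = perm_eq q (mask (map negb w) (down N)) && fits312 (mask w (down N)) q.
Proof.
move=> hw; set c := fun q => rev (map (subn N.+1) q).
have cK q' : all (leq^~ N) q' -> c (c q') = q' by exact: rev_complK.
have all_down m : all (leq^~ N.+1) (mask m (down N)).
  by apply: all_mask; apply/allP => x; rewrite mem_down => /andP[_] /leqW.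
have all_down' m : all (leq^~ N) (mask m (down N)).
  by apply: all_mask; apply/allP => x; rewrite mem_down => /andP[].
(* The map [c] fixes [down N], so applying it to a masked sublist amounts to reversing the mask. *)
have cmask m : size m = N -> mask (rev m) (down N) = c (mask m (down N)).
  by move=> hm; rewrite /c -[in LHS]rev_compl_down -rev_mask ?map_mask // size_map size_down.
have e1 : mask (flip w) (down N) = c (mask (map negb w) (down N)).
  by rewrite cmask ?size_map.
have e2 : mask (map negb (flip w)) (down N) = c (mask w (down N)).
  rewrite /flip map_rev -map_comp (eq_map (g := id)) ?map_id ?cmask // => b.
  exact: negbK.
have cperm u v : perm_eq u v -> perm_eq (c u) (c v).
  by move=> h; rewrite perm_rev perm_sym perm_rev perm_sym perm_map.
have szw : size (flip w) = size (down N) by rewrite size_flip size_down.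
have fitsE p : perm_eq p (mask (map negb w) (down N)) ->
    fits231 (c (mask w (down N))) (c p) = fits312 (mask w (down N)) p.
  move=> hp; rewrite (fits312_rev (N := N.+1)) ?(perm_all _ hp) //.
  by rewrite /fits231 /c all_rev.
apply/mapP/andP => [[p]|[hq hf]].
  rewrite mem_enum_fits ?down_pairwise // e1 e2 => /andP[hp hf] ->.
  have hq : perm_eq (c p) (mask (map negb w) (down N)).
    by rewrite (permPl (cperm _ _ hp)) cK.
  split=> //; rewrite -fitsE // cK //.
  rewrite (perm_all _ hp) /c all_rev all_map; apply: all_mask.
  by apply/allP => x; rewrite mem_down /=; lia.
have aq : all (leq^~ N) q by rewrite (perm_all _ hq).
exists (c q); last exact/esym/cK.
by rewrite mem_enum_fits ?down_pairwise // e1 e2 fitsE // hf cperm.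
Qed.

Lemma enum312_uniq N w : size w = N -> uniq (enum312 N w).
Proof.
move=> hw; have szw : size (flip w) = size (down N) by rewrite size_flip size_down.
rewrite map_inj_in_uniq ?enum_fits_uniq ?down_pairwise //.
have le p : p \in enum_fits (flip w) (down N) -> all (leq^~ N) p.
  rewrite mem_enum_fits ?down_pairwise // => /andP[/perm_all-> _].
  by apply: all_mask; apply/allP => x; rewrite mem_down => /andP[].
by move=> p q /le hp /le hq e; rewrite -(rev_complK hp) e rev_complK.
Qed.

Lemma perm_mask_negb (T : eqType) w (s : seq T) : size w = size s ->
  perm_eq (mask w s ++ mask (map negb w) s) s.
Proof.
elim: w s => [|b w IH] [|x s] //= [hw].
by case: b; rewrite /= ?perm_insert ?perm_cons IH.
Qed.

(** Recovers the word from the set of values it marks, so that different words contribute disjoint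
    families to [avoiders]. *)
Lemma map_mem_mask (T : eqType) w (s : seq T) : uniq s -> size w = size s ->
  [seq x \in mask w s | x <- s] = w.
Proof.
elim: w s => [|b w IH] [|x s] //= /andP[hx hs] [hw].
congr (_ :: _).
  by case: b; rewrite ?mem_head //; apply/negbTE; apply: contra hx; exact: mem_mask.
rewrite -[RHS](IH s hs hw); apply/eq_in_map => y hy.
case: b; rewrite // inE; case: eqP => // e.
by move: hx; rewrite -e hy.
Qed.

(* The letter 0 stands for the hole. *)
Definition avoiders (N : nat) : seq (seq nat) :=
  [seq t | w <- words N,
           t <- [seq p ++ 0 :: q | p <- enum_fits w (down N), q <- enum312 N w]].

Definition good_word (t : seq nat) : bool :=
  let p := take (index 0 t) t in let q := drop (index 0 t).+1 t in
  fits231 q p && fits312 p q.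

Lemma split_hole p q : 0 \notin p ->
  (index 0 (p ++ 0 :: q) = size p) * (take (index 0 (p ++ 0 :: q)) (p ++ 0 :: q) = p)
  * (drop (index 0 (p ++ 0 :: q)).+1 (p ++ 0 :: q) = q).
Proof.
move=> hp; have e : index 0 (p ++ 0 :: q) = size p.
  by rewrite index_cat (negPf hp) /= addn0.
by rewrite e take_size_cat // -cat1s catA drop_size_cat // size_cat addn1.
Qed.

Lemma notin_fits N w p : size w = N -> p \in enum_fits w (down N) -> 0 \notin p.
Proof.
move=> hw; rewrite mem_enum_fits ?size_down ?down_pairwise // => /andP[hp _].
by rewrite (perm_mem hp); apply/negP => /mem_mask; rewrite mem_down.
Qed.

Lemma avoiders_uniq N : uniq (avoiders N).
Proof.
apply: union_uniq => [|w|w w' t].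
- exact: words_uniq.
- rewrite mem_words => /eqP hw; apply: allpairs_uniq.
  + by rewrite enum_fits_uniq ?size_down ?down_pairwise.
  + exact: enum312_uniq.
  + move=> _ _ /allpairsP[[p q] [/= hp hq ->]] /allpairsP[[p' q'] [/= hp' hq' ->]] /= e.
    have h := split_hole q (notin_fits hw hp).
    have h' := split_hole q' (notin_fits hw hp').
    have -> : p = p' by rewrite -h.1.2 e h'.1.2.
    by have -> : q = q' by rewrite -h.2 e h'.2.
- rewrite !mem_words => /eqP hw /eqP hw'.
  move=> /allpairsP[[p q] [/= hp hq ->]] /allpairsP[[p' q'] [/= hp' hq' e]].
  have h := split_hole q (notin_fits hw hp).
  have h' := split_hole q' (notin_fits hw' hp').
  have epp : p = p' by rewrite -h.1.2 e h'.1.2.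
  move: hp hp'; rewrite -epp !mem_enum_fits ?size_down ?down_pairwise //.
  move=> /andP[/perm_mem hp _] /andP[/perm_mem hp' _].
  rewrite -(map_mem_mask (w := w) (down_uniq N)) ?size_down //.
  rewrite -[RHS](map_mem_mask (w := w') (down_uniq N)) ?size_down //.
  by apply: eq_map => x; rewrite -hp hp'.
Qed.

Lemma size_avoiders N : ((size (avoiders N))%:R = 2 * catalan N.+1 - 2 ^+ N :> rat)%R.
Proof.
rewrite -sum_words_wt size_allpairs_dep sumnE big_map natr_sum.
rewrite big_seq [RHS]big_seq; apply: eq_bigr => w; rewrite mem_words => /eqP hw.
by rewrite size_allpairs natrM size_map !size_enum_fits ?size_flip ?size_down.
Qed.

Lemma mem_avoiders N t :
  (t \in avoiders N) = perm_eq t (iota 0 N.+1) && good_word t.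
Proof.
(* The conditions depend on the opposite side only through its set of letters. *)
have fitsr B B' p : B =i B' -> fits231 B p = fits231 B' p.
  by move=> h; rewrite /fits231 (eq_all_r h).
have fitsr' B B' p : B =i B' -> fits312 B p = fits312 B' p.
  by move=> h; rewrite /fits312 (eq_all_r h).
apply/allpairsPdep/andP => [[w [_ [hw /allpairsP[[p q] [/= hp hq ->]] ->]]]|].
  move: hw; rewrite mem_words => /eqP hw.
  rewrite /good_word !(split_hole q (notin_fits hw hp)).
  move: hp hq; rewrite mem_enum_fits ?size_down ?down_pairwise // mem_enum312 //.
  move=> /andP[hp fp] /andP[hq fq].
  rewrite (fitsr _ _ _ (perm_mem hq)) (fitsr' _ _ _ (perm_mem hp)) fp fq; split=> //.
  rewrite perm_insert -(permPr (perm_down N)).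
  by rewrite (permPl (perm_cat hp hq)) perm_mask_negb ?size_down.
case=> ht; have h0 : 0 \in t by rewrite (perm_mem ht).
have := perm_uniq ht; rewrite iota_uniq.
case/splitPr: h0 ht => p q; rewrite perm_insert -(permPr (perm_down N)) => hpq.
rewrite cat_uniq /= negb_or => /and4P[hpu /andP[h0p hd] h0q hqu].
rewrite /good_word !(split_hole q h0p) => /andP[fp fq].
pose w := [seq x \in p | x <- down N].
have hw : size w = N by rewrite size_map size_down.
have pw : perm_eq p (mask w (down N)).
  rewrite -filter_mask; apply: uniq_perm => //; first by rewrite filter_uniq ?down_uniq.
  move=> x; rewrite mem_filter -(perm_mem hpq) mem_cat; case: (x \in p) => //.
have qw : perm_eq q (mask (map negb w) (down N)).
  by move: (perm_mask_negb (s := down N) (w := w)); rewrite size_down => /(_ hw);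
     rewrite -(permPr hpq) -(permPl (perm_cat pw (perm_refl _))) perm_cat2l perm_sym.
exists w, (p ++ 0 :: q); rewrite mem_words hw eqxx; split=> //.
apply/allpairsP; exists (p, q) => /=.
rewrite mem_enum312 // mem_enum_fits ?size_down ?down_pairwise //.
by rewrite pw qw -(fitsr _ _ _ (perm_mem qw)) fp -(fitsr' _ _ _ (perm_mem pw)) fq.
Qed.

(** * Occurrences of 2413 once the hole is filled *)

Lemma pairwise_subseqP (T : eqType) (r : rel T) s :
  reflect (forall x y, subseq [:: x; y] s -> r x y) (pairwise r s).
Proof.
apply: (iffP idP) => [h x y /subseq_pairwise/(_ h)|]; first by rewrite pairwise2.
elim: s => //= z s IH h; apply/andP; split.
  by apply/allP => y hy; apply: h; rewrite eqxx sub1seq.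
apply: IH => x y hxy; apply: h; case: eqP => // _.
by apply: subseq_trans hxy; exact: subseq_cons.
Qed.

Lemma triplewise_subseqP (T : eqType) (r : T -> T -> T -> bool) s :
  reflect (forall x y z, subseq [:: x; y; z] s -> r x y z) (triplewise r s).
Proof.
apply: (iffP idP) => [|]; elim: s => //= a s IH.
  move=> /andP[/pairwise_subseqP ha hs] x y z.
  by case: eqP => [-> /ha|_ /(IH hs)].
move=> h; apply/andP; split.
  by apply/pairwise_subseqP => y z hyz; apply: h; rewrite eqxx.
apply: IH => x y z hxyz; apply: h; case: eqP => // _.
by apply: subseq_trans hxyz; exact: subseq_cons.
Qed.

Lemma subseq_catP (T : eqType) (t s1 s2 : seq T) :
  reflect (exists t1 t2, [/\ t = t1 ++ t2, subseq t1 s1 & subseq t2 s2])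
    (subseq t (s1 ++ s2)).
Proof.
apply: (iffP idP) => [/subseqP[m hm ->]|[t1 [t2 [-> h1 h2]]]]; last exact: cat_subseq.
exists (mask (take (size s1) m) s1), (mask (drop (size s1) m) s2).
rewrite !mask_subseq -mask_cat ?cat_take_drop // size_take_min hm size_cat.
by rewrite (minn_idPl _) ?leq_addr.
Qed.

Definition occurs2413 (s : seq nat) : Prop :=
  exists a b c d, subseq [:: a; b; c; d] s /\ [&& c < a, a < d & d < b].

Lemma std2413 a b c d : (std [:: a; b; c; d] == [:: 2; 4; 1; 3]) = [&& c < a, a < d & d < b].
Proof.
rewrite /std /= !leqnn; apply/eqP/idP => [[] |]; first by lia.
move=> h; congr [:: _; _; _; _]; lia.
Qed.

Lemma contains2413P s : reflect (occurs2413 s) (contains s [:: 2; 4; 1; 3]).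
Proof.
apply: (iffP existsP) => [[m hm]|[a [b [c [d [/subseqP[m hm e] h]]]]]].
  have : size (std (mask m s)) = 4 by rewrite (eqP hm).
  rewrite size_map.
  case e : (mask m s) => [|a [|b [|c [|d []]]]] // _; exists a, b, c, d.
  by rewrite -e mask_subseq -std2413 -e.
by exists (tcast hm (in_tuple m)); rewrite val_tcast /= -e std2413.
Qed.

Lemma fits231_mono f B p : {mono f : x y / x <= y} ->
  fits231 (map f B) (map f p) = fits231 B p.
Proof.
move=> hf; have lt := leqW_mono hf; rewrite /fits231; congr (_ && _).
  rewrite /avoid231 triplewise_map.
  by apply: (@eq_in_triplewise _ predT); [move=> x y z _ _ _; rewrite !lt | exact/all_predT].
rewrite all_map; apply: eq_all => c /=; rewrite /no_jump pairwise_map.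
by apply: eq_pairwise => x y /=; rewrite !lt.
Qed.

Lemma fits312_mono f A q : {mono f : x y / x <= y} ->
  fits312 (map f A) (map f q) = fits312 A q.
Proof.
move=> hf; have lt := leqW_mono hf; rewrite /fits312; congr (_ && _).
  rewrite /avoid312 triplewise_map.
  by apply: (@eq_in_triplewise _ predT); [move=> x y z _ _ _; rewrite !lt | exact/all_predT].
rewrite all_map; apply: eq_all => c /=; rewrite /no_jump pairwise_map.
by apply: eq_pairwise => x y /=; rewrite !lt.
Qed.

(** The cases follow the number of pattern letters taken from [p]. With none, [b c d] is a 312 in
    [q]; with one, [c d] jumps over [a]; with two, [a b] jumps over [d]; with three or more, [a b c]
    is a 231 in [p]. *)
Lemma fits_no2413 v p q : fits231 q p -> fits312 p q -> ~ occurs2413 (p ++ v :: q).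
Proof.
move=> /andP[/triplewise_subseqP h231 /allP jp] /andP[/triplewise_subseqP h312 /allP jq].
move=> [a [b [c [d [/subseq_catP[t1 [t2 [e h1 h2]]] h]]]]].
(* Only the first letter taken after [p] can be the inserted [v]; dropping it leaves letters of
   [q]. *)
have behead_sub x t : subseq (x :: t) (v :: q) -> subseq t q.
  rewrite /=; case: eqP => // _; apply: subseq_trans; exact: subseq_cons.
case: t1 e h1 => [|a1 [|b1 [|c1 t1]]].
- move=> /= e _; move: h2; rewrite -e => /behead_sub /h312 /=; lia.
- move=> [<- e]; rewrite sub1seq => ha; move: h2; rewrite -e => /behead_sub hcd.
  by move/pairwise_subseqP: (jq a ha) => /(_ c d hcd) /=; lia.
- move=> [<- <- e] hab; move: h2; rewrite -e => /behead_sub; rewrite sub1seq => hd.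
  by move/pairwise_subseqP: (jp d hd) => /(_ a b hab) /=; lia.
- move=> [<- <- <- _] hab.
  have : subseq [:: a; b; c] p by apply: subseq_trans hab; exact: prefix_subseq.
  by move/h231 => /=; lia.
Qed.

Lemma bump_mono v : {mono bump v : x y / x <= y}.
Proof. by move=> x y; rewrite leq_bump2. Qed.

Lemma no2413_fits N p q : all (fun x => 0 < x <= N) (p ++ q) ->
  (forall v, 0 < v <= N.+1 -> ~ occurs2413 (map (bump v) p ++ v :: map (bump v) q)) ->
  fits231 q p && fits312 p q.
Proof.
move=> hr h; have {}hr x : x \in p ++ q -> 0 < x <= N by move/allP: hr; apply.
have hrp x t : x \in t -> subseq t p -> 0 < x <= N.
  by move=> hx /mem_subseq/(_ x hx) hp; apply: hr; rewrite mem_cat hp.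
have hrq x t : x \in t -> subseq t q -> 0 < x <= N.
  by move=> hx /mem_subseq/(_ x hx) hq; apply: hr; rewrite mem_cat hq orbT.
have sub v t1 t2 : subseq t1 p -> subseq t2 q ->
    subseq (map (bump v) t1 ++ v :: map (bump v) t2) (map (bump v) p ++ v :: map (bump v) q).
  by move=> h1 h2; rewrite cat_subseq ?map_subseq //= eqxx map_subseq.
apply/andP; split; apply/andP; split.
- apply/triplewise_subseqP => x y z hs; apply/negP => hlt.
  have hx := hrp x _ (mem_head _ _) hs.
  (* The hole plays 3, just above the letter [x] that plays 2. *)
  apply: (h x.+1); first by lia.
  exists (bump x.+1 x), (bump x.+1 y), (bump x.+1 z), x.+1; split.
    exact: (sub _ _ [::] hs (sub0seq _)).
  by rewrite /bump; lia.
- apply/allP => c hc; apply/pairwise_subseqP => a b hs; apply/negP => hlt.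
  (* The hole plays 1, with the least value. *)
  apply: (h 1) => //; exists (bump 1 a), (bump 1 b), 1, (bump 1 c); split.
    by apply: (sub _ _ [:: c] hs); rewrite sub1seq.
  have := hrp a _ (mem_head _ _) hs.
  by rewrite /bump; lia.
- apply/triplewise_subseqP => x y z hs; apply/negP => hlt.
  have hx := hrq x _ (mem_head _ _) hs.
  (* The hole plays 2, just above the letter [y] that plays 1. *)
  apply: (h y.+1); first by lia.
  exists y.+1, (bump y.+1 x), (bump y.+1 y), (bump y.+1 z); split.
    exact: (sub _ [::] _ (sub0seq _) hs).
  by rewrite /bump; lia.
- apply/allP => a ha; apply/pairwise_subseqP => b c hs; apply/negP => hlt.
  have hb := hrq b _ (mem_head _ _) hs.
  have hc : 0 < c <= N by apply: (hrq c _ _ hs); rewrite !inE eqxx orbT.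
  (* The hole plays 4, with the greatest value. *)
  apply: (h N.+1); first by lia.
  exists (bump N.+1 a), N.+1, (bump N.+1 b), (bump N.+1 c); split.
    by apply: (sub _ [:: a] _ _ hs); rewrite sub1seq.
  have : 0 < a <= N by apply: hr; rewrite mem_cat ha.
  by rewrite /bump; lia.
Qed.

Lemma no2413E N p q : perm_eq (p ++ q) (iota 1 N) ->
  (forall v, 0 < v <= N.+1 -> ~ occurs2413 (map (bump v) p ++ v :: map (bump v) q))
  <-> fits231 q p && fits312 p q.
Proof.
move=> hpq; split=> [h|/andP[h1 h2] v _].
  apply: no2413_fits h; rewrite (perm_all _ hpq).
  by apply/allP => x; rewrite mem_iota; lia.
by apply: fits_no2413; rewrite ?fits231_mono ?fits312_mono //; exact: bump_mono.
Qed.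

(** * Extensions of a partial permutation *)

Lemma perm_subset (T : eqType) (s1 s2 : seq T) : uniq s1 -> {subset s1 <= s2} ->
  size s2 <= size s1 -> perm_eq s1 s2.
Proof.
move=> h1 h2 h3; apply: uniq_perm => //; first exact: leq_size_uniq h2 h3.
by have [] := uniq_min_size h1 h2 h3.
Qed.

Lemma count_leq_iota x n : count (leq^~ x) (iota 1 n) = minn x n.
Proof.
elim: n => [|n IH]; first by rewrite minn0.
by rewrite -{1}[n.+1]addn1 iotaD count_cat IH /=; lia.
Qed.

(** In the whole permutation the rank of [x] is [x] itself; removing [v] lowers it by one exactly
    when [v] is below [x]. *)
Lemma std_rem (n v : nat) (s : seq nat) :
  perm_eq (v :: s) (iota 1 n) -> std s = map (unbump v) s.
Proof.
move=> hs; apply/eq_in_map => x hx.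
have /andP[hv _] : uniq (v :: s) by rewrite (perm_uniq hs) iota_uniq.
have hvx : v != x by apply: contraNneq hv => ->.
have : x \in iota 1 n by rewrite -(perm_mem hs) inE hx orbT.
have := seq.permP hs (leq^~ x); rewrite count_leq_iota mem_iota /= /unbump.
lia.
Qed.

Lemma perm_bump (n v : nat) (s : seq nat) : 0 < v <= n.+1 -> perm_eq s (iota 1 n) ->
  perm_eq (v :: map (bump v) s) (iota 1 n.+1).
Proof.
move=> hv hs; apply: uniq_perm; rewrite ?iota_uniq //.
  rewrite /= map_inj_uniq ?(perm_uniq hs) ?iota_uniq ?andbT; last first.
    by move=> x y e; apply: (can_inj (bumpK v)).
  by apply/mapP => -[x _ e]; have := neq_bump v x; rewrite -e eqxx.
move=> x; rewrite inE (perm_mem (perm_map _ hs)).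
apply/predU1P/idP => [[->|/mapP[y + ->]]|hx]; rewrite ?mem_iota /bump; try lia.
case: (eqVneq x v) => [|hxv]; [by left | right].
apply/mapP; exists (unbump v x); last by rewrite -/(bump v _) unbumpK.
by move: hx; rewrite !mem_iota /unbump; lia.
Qed.

(** An extension is determined by the value [v] it puts in the hole: standardizing the other letters
    is [unbump v], which [bump v] undoes. *)
Lemma extension_wordP (N : nat) (p q w : seq nat) : perm_eq (p ++ q) (iota 1 N) ->
  perm_eq w (iota 1 N.+1) ->
  reflect (exists2 v, 0 < v <= N.+1 & w = map (bump v) p ++ v :: map (bump v) q)
   (std (mask (nseq (size p) true ++ false :: nseq (size q) true) w) == p ++ q).
Proof.
move=> hpq hw.
have szpq : size p + size q = N by rewrite -size_cat (perm_size hpq) size_iota.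
have szw : size w = N.+1 by rewrite (perm_size hw) size_iota.
(* The default 0 is not reached, because [w] has [size p + size q + 1] letters. *)
pose v := nth 0 w (size p).
have ew : w = take (size p) w ++ v :: drop (size p).+1 w.
  by rewrite -drop_nth ?cat_take_drop // szw -szpq ltnS leq_addr.
have szt : size (take (size p) w) = size p by rewrite size_takel // szw; lia.
have szd : size (drop (size p).+1 w) = size q by rewrite size_drop szw; lia.
have hv : perm_eq (v :: (take (size p) w ++ drop (size p).+1 w)) (iota 1 N.+1).
  by rewrite -(seq.permPr hw) [X in perm_eq _ X]ew perm_sym perm_insert.
have -> : mask (nseq (size p) true ++ false :: nseq (size q) true) w
    = take (size p) w ++ drop (size p).+1 w.
  rewrite {1}ew mask_cat ?size_nseq // mask_true ?szt // mask_cons /=.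
  by rewrite mask_true ?szd.
rewrite (std_rem hv); apply: (iffP eqP) => [e|[u hu e]].
  exists v; first by have := perm_mem hv v; rewrite mem_head mem_iota; lia.
  have : map (bump v) (p ++ q) = take (size p) w ++ drop (size p).+1 w.
    rewrite -e -map_comp map_id_in // => x hx /=; rewrite unbumpK // inE.
    have : uniq (v :: (take (size p) w ++ drop (size p).+1 w)).
      by rewrite (perm_uniq hv) iota_uniq.
    by move=> /andP[+ _]; apply: contraNneq => <-.
  rewrite map_cat => /eqP; rewrite eqseq_cat ?size_map ?szt // => /andP[/eqP-> /eqP->].
  exact: ew.
have -> : v = u by rewrite /v e nth_cat size_map ltnn subnn.
have -> : take (size p) w = map (bump u) p.
  by rewrite e take_size_cat ?size_map.
have -> : drop (size p).+1 w = map (bump u) q.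
  by rewrite e -cat1s catA drop_size_cat // size_cat size_map addn1.
by rewrite -map_cat -map_comp map_id_in // => x _ /=; rewrite bumpK.
Qed.

Lemma perm_word_perm n (s : 'S_n) : perm_eq (perm_word s) (iota 1 n).
Proof.
have hu : uniq (perm_word s).
  by rewrite map_inj_uniq ?enum_uniq // => i j [] /val_inj /perm_inj.
apply: perm_subset => //; last by rewrite size_iota size_map size_enum_ord.
by move=> x /mapP[i _ ->]; rewrite mem_iota /= add1n ltnS.
Qed.

Lemma perm_word_surj n (w : seq nat) :
  perm_eq w (iota 1 n) -> exists s : 'S_n, perm_word s = w.
Proof.
(* The empty permutation is separate because [inord] needs a nonempty ordinal type. *)
case: n => [|n] hw.
  exists 1%g; move/perm_nilP: hw => ->; apply/nilP.
  by rewrite /nilp size_map size_enum_ord.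
have szw : size w = n.+1 by rewrite (perm_size hw) size_iota.
have rw i : i < n.+1 -> 0 < nth 0 w i <= n.+1.
  move=> hi; have := @mem_nth _ 0 w i.
  by rewrite szw (perm_mem hw) mem_iota add1n ltnS => /(_ hi).
pose f (i : 'I_n.+1) : 'I_n.+1 := inord (nth 0 w i).-1.
have fE i : (val (f i)).+1 = nth 0 w i.
  by rewrite /f /= inordK; have := rw i (ltn_ord i); lia.
have finj : injective f.
  move=> i j /(congr1 (fun k => (val k).+1)); rewrite !fE => /eqP.
  by rewrite nth_uniq ?szw ?(perm_uniq hw) ?iota_uniq // => /eqP /val_inj.
exists (perm finj); rewrite /perm_word.
rewrite (eq_map (g := fun i : 'I_n.+1 => nth 0 w i)) => [|i]; last by rewrite permE fE.
rewrite (map_comp (nth 0 w) val) val_enum_ord -szw; exact: mkseq_nth.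
Qed.

(** * Coding partial permutations as words in which 0 marks the hole *)

Definition letter {N : nat} (x : option 'I_N.+1) : nat := oapp val 0 x.
Definition unletter (N k : nat) : option 'I_N.+1 :=
  if k is 0 then None else Some (inord k).

(** Both [None] and [Some ord0] have code 0, so decoding is faithful only away from [Some ord0]. *)
Lemma letterK N (x : option 'I_N.+1) : x != Some ord0 -> unletter N (letter x) = x.
Proof.
case: x => [[[|k] hk]|] // h.
by congr Some; apply: val_inj; rewrite /= inordK.
Qed.

Lemma unletterK N k : k < N.+1 -> letter (unletter N k) = k.
Proof. by case: k => // k hk; rewrite /letter /= inordK. Qed.

Lemma partial_perm_code N (pi : N.+1.-tuple (option 'I_N.+1)) : is_partial_perm1 pi ->
  perm_eq (map letter pi) (iota 0 N.+1) /\ Some ord0 \notin pi.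
Proof.
move=> /andP[/eqP hN /forallP hv].
have hp : perm_eq (map letter pi) (iota 0 N.+1).
  rewrite perm_sym; apply: perm_subset; rewrite ?iota_uniq //; last first.
    by rewrite size_map size_tuple size_iota.
  move=> k; rewrite mem_iota add0n => /andP[_ hk]; case: k hk => [|k] hk; apply/mapP.
    by exists None => //; rewrite -has_pred1 has_count hN.
  exists (Some (Ordinal hk)) => //; have := hv (Ordinal hk).
  by rewrite /= -has_pred1 has_count => /eqP->.
(* A letter [Some ord0] would give the code 0 a second time besides the hole, but 0 occurs once in
   the coded word. *)
split=> //; apply/negP => h0.
have := seq.permP hp (pred1 0).
rewrite (count_uniq_mem 0 (iota_uniq _ _)) mem_iota /= count_map.
have cI : count (predI (pred1 None) (pred1 (Some (@ord0 N)))) pi = 0.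
  by rewrite -(count_pred0 pi); apply: eq_count => -[].
have := count_predUI (pred1 None) (pred1 (Some (@ord0 N))) pi.
rewrite cI addn0 hN => cU e.
have : count (predU (pred1 None) (pred1 (Some ord0))) pi <= count (preim letter (pred1 0)) pi.
  by apply: sub_count => x /orP[] /eqP->.
by rewrite cU e leqNgt add1n ltnS -has_count has_pred1 h0.
Qed.

Lemma code_partial_perm N (t : seq nat) : perm_eq t (iota 0 N.+1) ->
  exists2 pi : N.+1.-tuple (option 'I_N.+1), is_partial_perm1 pi & map letter pi = t.
Proof.
move=> ht; have szt : size (map (unletter N) t) == N.+1.
  by rewrite size_map (perm_size ht) size_iota.
have lt k : k \in t -> k < N.+1 by rewrite (perm_mem ht) mem_iota.
have cnt k : k < N.+1 -> count (fun j => unletter N j == unletter N k) t = 1.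
  move=> hk; rewrite (eq_in_count (a2 := pred1 k)) => [|j hj].
    by rewrite (seq.permP ht) count_uniq_mem ?iota_uniq // mem_iota hk.
  apply/eqP/eqP => [e|-> //].
  by rewrite -(unletterK (lt _ hj)) e unletterK.
exists (Tuple szt) => /=.
  apply/andP; split; first by rewrite /= count_map; apply/eqP; exact: (cnt 0).
  apply/forallP => v; apply/implyP => hv; rewrite /= count_map; apply/eqP.
  rewrite -(cnt v) ?ltn_ord //; apply: eq_count => j /=; congr (_ == _).
  case: v hv => -[|k] hk //= _; congr Some; apply: val_inj; by rewrite /= inordK.
by rewrite -map_comp map_id_in // => k /lt hk /=; rewrite unletterK.
Qed.

Lemma pavoids2413 N (pi : N.+1.-tuple (option 'I_N.+1)) (p q : seq nat) :
  Some ord0 \notin pi -> map letter pi = p ++ 0 :: q ->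
  perm_eq (p ++ q) (iota 1 N) ->
  pavoids pi [:: 2; 4; 1; 3] = fits231 q p && fits312 p q.
Proof.
move=> h0 e hpq.
have nz : 0 \notin p ++ q by rewrite (perm_mem hpq) mem_iota.
have isE : map isSome pi = nseq (size p) true ++ false :: nseq (size q) true.
  have -> : map isSome pi = map (fun k => k != 0) (map letter pi).
    rewrite -map_comp; apply/eq_in_map => -[[[|k] hk]|] //= hx.
    move: h0; rewrite (_ : Some ord0 = Some (Ordinal hk)) ?hx //.
    by congr Some; exact: val_inj.
  rewrite e map_cat /=; move: nz; rewrite mem_cat negb_or => /andP[hp hq].
  have nzT r : 0 \notin r -> map (fun k => k != 0) r = nseq (size r) true.
    by elim: r => //= k r IH; rewrite inE negb_or eq_sym => /andP[-> /IH->].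
  by rewrite !nzT.
have valE : [seq val v | v <- pmap id pi] = p ++ q.
  have -> : [seq val v | v <- pmap id pi] = filter (fun k => k != 0) (map letter pi).
    move: (h0 : Some ord0 \notin tval pi); elim: (tval pi) => // x s IH.
    rewrite inE negb_or => /andP[hx /IH].
    case: x hx => [v|] hx /= -> //.
    rewrite ifT //; apply: contraNneq hx => v0; apply/eqP; congr Some.
    by apply: val_inj; rewrite /= v0.
  rewrite e filter_cat /= -filter_cat; apply/all_filterP/allP => x hx.
  by apply: contraNneq nz => <-.
(* Each admissible value [v] is realized by a permutation that extends [pi], and each extension
   arises from such a [v]. *)
apply/forallP/idP => [h|/(no2413E hpq) h s].
  apply/(no2413E hpq) => v hv /contains2413P.
  have hw : perm_eq (map (bump v) p ++ v :: map (bump v) q) (iota 1 N.+1).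
    apply: perm_trans (perm_bump hv hpq).
    by rewrite map_cat perm_insert.
  have [s es] := perm_word_surj hw.
  apply/negP; rewrite -es; apply: (implyP (h s)).
  by rewrite /is_extension isE valE es; apply/(extension_wordP hpq hw); exists v.
apply/implyP; rewrite /is_extension isE valE.
move=> /(extension_wordP hpq (perm_word_perm s)) [v hv ->].
by apply/contains2413P; exact: h.
Qed.

Lemma s1_2413 N : s1 N.+1 [:: 2; 4; 1; 3] = size (avoiders N).
Proof.
rewrite /s1; set S := finset _.
have codeP pi : pi \in S -> [/\ perm_eq (map letter pi) (iota 0 N.+1), Some ord0 \notin pi
   & pavoids pi [:: 2; 4; 1; 3]].
  by rewrite inE => /andP[/partial_perm_code[h1 h2] h3].
have split t : perm_eq t (iota 0 N.+1) -> exists p q,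
    [/\ t = p ++ 0 :: q, perm_eq (p ++ q) (iota 1 N)
      & good_word t = fits231 q p && fits312 p q].
  move=> ht; have h : 0 \in t by rewrite (perm_mem ht).
  case/splitPr: h ht => p q; rewrite perm_insert => hpq; exists p, q; split=> //.
  have hp : 0 \notin p.
    by have := perm_mem (hpq : perm_eq _ (iota 1 N)) 0; rewrite mem_cat mem_iota => /norP[].
  by rewrite /good_word !(split_hole q hp).
rewrite cardE -(size_map (fun pi => map letter (val pi))).
(* Coding by [letter] is injective on the counted set, so it suffices that the two duplicate-free
   lists have the same members. *)
apply/perm_size/uniq_perm; rewrite ?avoiders_uniq //.
  rewrite map_inj_in_uniq ?enum_uniq // => pi pi'.
  rewrite !mem_enum => /codeP[_ h _] /codeP[_ h' _] e; apply: val_inj => /=.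
  have K (r : seq (option 'I_N.+1)) : Some ord0 \notin r ->
      map (unletter N) (map letter r) = r.
    move=> hr; rewrite -map_comp map_id_in // => x hx; apply: letterK.
    by apply: contraNneq hr => <-.
  by rewrite -(K _ h) e K.
move=> t; rewrite mem_avoiders; apply/mapP/andP => [[pi]|[ht]].
  rewrite mem_enum => /codeP[hp h0 hav] ->; split=> //.
  have [p [q [e hpq ->]]] := split _ hp.
  by rewrite -(pavoids2413 h0 e hpq).
have [p [q [e hpq ->]]] := split _ ht => hg.
have [pi hpi epi] := code_partial_perm ht.
exists pi => //; rewrite mem_enum inE hpi.
have [_ h0] := partial_perm_code hpi.
by rewrite (pavoids2413 h0 _ hpq) // epi.
Qed.

Local Open Scope ring_scope.

Theorem theorem33 (n : nat) (hn : (1 <= n)%N) :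
  (s1 n [:: 2; 4; 1; 3]%N)%:R
    = 2%:R / (n + 1)%:R * 'C(2 * n, n)%:R - 2%:R ^+ (n - 1) :> rat.
Proof.
case: n hn => // N _; rewrite s1_2413 size_avoiders /catalan subn1 addn1.
by rewrite -mulrA [_^-1 * _]mulrC.
Qed.
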